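(* Let $(X,\|\cdot\|)$ be a real normed space, let $X_o = X\setminus\{o\}$, and let $\mathrm{ang_p}:X_o\times X_o\to\mathbb{R}$ be its P-angle, $$\mathrm{ang_p}(x,y)=\arccos\left(\frac{\|x\|^2+\|y\|^2-\|x-y\|^2}{2\|x\|\,\|y\|}\right).$$ Then the following are equivalent: (a) (non-degeneracy) for all $x,y\in X_o$: $\mathrm{ang_p}(x,y)=0$ if and only if $x=\alpha y$ for some $\alpha>0$; (b) (parallelism) for all $x,y\in X_o$: $\mathrm{ang_p}(x,y)=\pi$ if and only if $y=\alpha x$ for some $\alpha<0$; (c) $(X,\|\cdot\|)$ is strictly convex.
   Context: $\arccos:[-1,1]\to[0,\pi]$ is the usual inverse cosine; the argument lies in $[-1,1]$ by the triangle inequality. A normed space is strictly convex if its unit sphere contains no non-degenerate line segment. *)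

(* Defs.v *)
From mathcomp Require Export all_boot all_order all_algebra.
From mathcomp Require Export boolp classical_sets set_interval reals.
From mathcomp Require Export topology normedtype trigo.

Set Implicit Arguments.
Unset Strict Implicit.
Unset Printing Implicit Defensive.

Export Order.TTheory GRing.Theory Num.Theory.
Export numFieldNormedType.Exports.

Local Open Scope classical_set_scope.
Local Open Scope ring_scope.

(* Total on [X * X]; only meaningful for nonzero [x] and [y], in which case the
   argument of [acos] lies in [-1, 1]. *)
Definition ang_p (R : realType) (X : normedModType R) (x y : X) : R :=
  acos ((`|x| ^+ 2 + `|y| ^+ 2 - `|x - y| ^+ 2) / (2 * `|x| * `|y|)).

Definition unit_sphere (R : realType) (X : normedModType R) : set X :=
  [set x | `|x| = 1].
Arguments unit_sphere {R} X.

Definition line_segment (R : realType) (X : normedModType R) (x y : X) : set X :=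
  [set (1 - t) *: x + t *: y | t in `[0 : R, 1]].

Definition strictly_convex (R : realType) (X : normedModType R) : Prop :=
  forall x y : X, x != y -> ~ (line_segment x y `<=` unit_sphere X).

(* Main.v *)
(** Clearing denominators, [ang_p x y = 0] says [`|x - y| = `| `|x| - `|y| |] and
    [ang_p x y = pi] says [`|x - y| = `|x| + `|y|]: both are equality cases of
    the triangle inequality.  Replacing [(x, y)] by [(x - y, x)] turns the second
    into the first.  If [u] and [v] achieve equality in the triangle inequality,
    so do all their nonnegative combinations, so the segment joining [u / `|u|]
    to [v / `|v|] lies on the unit sphere. *)
Require Import Defs.
From mathcomp Require Import ring lra.

Local Open Scope ring_scope.

Section PAngle.
Set Implicit Arguments.
Unset Strict Implicit.
Variables (R : realType) (X : normedModType R).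
Implicit Types x y u v : X.

(** The triangle inequality and its two reverse forms give [(|x| - |y|)^2 <= |x - y|^2 <= (|x| +
    |y|)^2], which places the argument of [acos] in [-1, 1]. *)
Lemma cos_ang_p x y : x != 0 -> y != 0 ->
  cos (ang_p x y) = (`|x| ^+ 2 + `|y| ^+ 2 - `|x - y| ^+ 2) / (2 * `|x| * `|y|).
Proof.
rewrite -!normr_gt0 => x0 y0; rewrite /ang_p acosK // in_itv /=.
have d0 : 0 < 2 * `|x| * `|y| by rewrite !mulr_gt0.
have := ler_normB x y; have := lerB_dist x y; have := lerB_dist y x.
rewrite (distrC y x) ler_pdivlMr // ler_pdivrMr //.
move: `|x - y| `|x| `|y| x0 y0 (normr_ge0 (x - y)) {d0} => d a b a0 b0 d0 h1 h2 h3.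
by apply/andP; split; nra.
Qed.

Lemma ang_p_eq0 x y : x != 0 -> y != 0 ->
  ang_p x y = 0 <-> `|x - y| = `| `|x| - `|y| |.
Proof.
move=> x0 y0.
have d0 : 2 * `|x| * `|y| != 0 by rewrite !mulf_neq0 ?normr_eq0 ?pnatr_eq0.
split=> [a0|e].
- have := cos_ang_p x0 y0; rewrite a0 cos0 => /esym/(canRL (divfK d0)) e.
  apply/eqP; rewrite -(@eqrXn2 _ 2) // real_normK ?num_real //; apply/eqP; lra.
- rewrite /ang_p e real_normK ?num_real // -acos1; congr acos.
  by apply/(canLR (mulfK d0)); ring.
Qed.

Lemma ang_p_eqpi x y : x != 0 -> y != 0 ->
  ang_p x y = pi <-> `|x - y| = `|x| + `|y|.
Proof.
move=> x0 y0.
have d0 : 2 * `|x| * `|y| != 0 by rewrite !mulf_neq0 ?normr_eq0 ?pnatr_eq0.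
split=> [api|e].
- have := cos_ang_p x0 y0; rewrite api cospi => /esym/(canRL (divfK d0)) e.
  by apply/eqP; rewrite -(@eqrXn2 _ 2) ?addr_ge0 //; apply/eqP; lra.
- rewrite /ang_p e -acosN1; congr acos.
  by apply/(canLR (mulfK d0)); ring.
Qed.

Lemma ang_p_scale_pos (alpha : R) y : 0 < alpha -> y != 0 ->
  ang_p (alpha *: y) y = 0.
Proof.
move=> a0 y0; apply/ang_p_eq0 => //; first by rewrite scaler_eq0 gt_eqF.
rewrite -[X in _ - X]scale1r -scalerBl !normrZ (gtr0_norm a0).
by rewrite -[X in _ * _ - X]mul1r -mulrBl normrM normr_id.
Qed.

Lemma ang_p_scale_neg (alpha : R) x : alpha < 0 -> x != 0 ->
  ang_p x (alpha *: x) = pi.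
Proof.
move=> a0 x0; apply/ang_p_eqpi => //; first by rewrite scaler_eq0 lt_eqF.
rewrite -[X in X - _]scale1r -scalerBl !normrZ (ltr0_norm a0) gtr0_norm; last by lra.
by rewrite mulrBl mul1r mulNr.
Qed.

(** For [b <= a], the reverse triangle inequality applied to [a (u + v) - (a - b) v] bounds the norm
    below by [a (|u| + |v|) - (a - b) |v|], which is the right-hand side. *)
Lemma norm_comb_eq (a b : R) u v : 0 <= a -> 0 <= b ->
  `|u + v| = `|u| + `|v| -> `|a *: u + b *: v| = a * `|u| + b * `|v|.
Proof.
wlog ba : a b u v / b <= a => [hw a0 b0 e|a0 b0 e].
  have [|/ltW ab] := leP b a; first by move/hw; apply.
  by rewrite addrC (hw b a v u) //; [rewrite addrC | rewrite addrC e addrC].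
apply/eqP; rewrite eq_le; apply/andP; split.
  by rewrite (le_trans (ler_normD _ _)) // !normrZ !ger0_norm.
have -> : a *: u + b *: v = a *: (u + v) - (a - b) *: v.
  by rewrite scalerDr scalerBl opprB -addrA subrKC.
apply: le_trans (lerB_dist _ _).
rewrite !normrZ e !ger0_norm ?subr_ge0 //; lra.
Qed.

Lemma strictly_convex_normD u v : strictly_convex X -> u != 0 -> v != 0 ->
  `|u + v| = `|u| + `|v| -> u = (`|u| / `|v|) *: v.
Proof.
move=> sc u0 v0 e.
have nu : `|u| != 0 by rewrite normr_eq0.
have nv : `|v| != 0 by rewrite normr_eq0.
have [uv|/sc[]] := eqVneq (`|u|^-1 *: u) (`|v|^-1 *: v).
  by rewrite -scalerA -uv scalerA divff // scale1r.
move=> _ [t /= /[!in_itv]/= /andP[t0 t1] <-]; rewrite /unit_sphere /= !scalerA.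
rewrite norm_comb_eq // ?mulr_ge0 ?invr_ge0 ?subr_ge0 //.
by rewrite !mulfVK // subrK.
Qed.

End PAngle.

Theorem lemma3p1p1 (R : realType) (X : normedModType R) :
  [<-> (forall x y : X, x != 0 -> y != 0 ->
          (ang_p x y = 0 <-> exists2 alpha : R, 0 < alpha & x = alpha *: y));
       (forall x y : X, x != 0 -> y != 0 ->
          (ang_p x y = pi <-> exists2 alpha : R, alpha < 0 & y = alpha *: x));
       strictly_convex X].
Proof.
tfae.
- move=> nondeg x y x0 y0; split=> [|[al al0 ->]]; last exact: ang_p_scale_neg.
  move/(ang_p_eqpi x0 y0) => e.
  have nx : 0 < `|x| by rewrite normr_gt0.
  have ny : 0 < `|y| by rewrite normr_gt0.
  have u0 : x - y != 0 by rewrite -normr_gt0 e addr_gt0.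
  (* The angle between [x - y] and [x] vanishes, since [|(x - y) - x| = |y| = |x - y| - |x|]. *)
  have [] := (nondeg _ _ u0 x0).1.
    apply/ang_p_eq0 => //.
    by rewrite addrAC subrr sub0r normrN e addrAC subrr add0r normr_id.
  move=> al al0 E; exists (1 - al); last first.
    by rewrite scalerBl scale1r -E subKr.
  (* Here [al |x| = |x| + |y| > |x|], so [al > 1]. *)
  move: e; rewrite E normrZ (gtr0_norm al0); nra.
- move=> par x y xy sub.
  have nx : `|x| = 1.
    by apply: sub; exists 0; rewrite /= ?in_itv /= ?lexx ?ler01 // subr0 scale1r scale0r addr0.
  have ny : `|y| = 1.
    by apply: sub; exists 1; rewrite /= ?in_itv /= ?lexx ?ler01 // subrr scale0r scale1r add0r.
  (* The midpoint is enough: its norm gives [|x - (- y)| = 2 = |x| + |- y|], so [x] and [- y] form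
     the angle [pi]. Comparing norms in [- y = al x] then forces [al = -1], hence [x = y]. *)
  have nm : `|2^-1 *: (x + y)| = 1.
    apply: sub; exists 2^-1; first by rewrite /= in_itv /=; lra.
    by rewrite scalerDr; congr (_ *: _ + _); field.
  have x0 : x != 0 by rewrite -normr_eq0 nx oner_eq0.
  have y0 : - y != 0 by rewrite oppr_eq0 -normr_eq0 ny oner_eq0.
  have [] := (par _ _ x0 y0).1.
    apply/ang_p_eqpi => //; rewrite opprK normrN nx ny.
    by move: nm; rewrite normrZ gtr0_norm ?invr_gt0 //; lra.
  move=> al al0 E; have := congr1 Num.norm E.
  rewrite normrN normrZ nx ny mulr1 ltr0_norm // => al1.
  move: E; rewrite -[al]opprK -al1 scaleN1r => /oppr_inj yx.
  by rewrite yx eqxx in xy.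
- move=> sc x y x0 y0; split=> [|[al al0 ->]]; last exact: ang_p_scale_pos.
  move/(ang_p_eq0 x0 y0).
  wlog yx : x y x0 y0 / `|y| <= `|x| => [hw e|].
    have [yx|/ltW xy] := leP `|y| `|x|; first exact: hw.
    have [|al al0 ->] := hw y x y0 x0 xy; first by rewrite distrC e distrC.
    exists al^-1; first by rewrite invr_gt0.
    by rewrite scalerA mulVf ?scale1r // gt_eqF.
  rewrite ger0_norm ?subr_ge0 // => e.
  have [->|nxy] := eqVneq x y; first by exists 1; rewrite ?scale1r.
  have u0 : x - y != 0 by rewrite subr_eq0.
  (* Equality is attained by [x - y] and [y], whose norms add up to [|x|]; thus [x - y] is a
     nonnegative multiple of [y]. *)
  have := strictly_convex_normD sc u0 y0; rewrite e !subrK => /(_ erefl) E.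
  exists (1 + (`|x| - `|y|) / `|y|).
    by rewrite ltr_wpDr // divr_ge0 // subr_ge0.
  by rewrite scalerDl scale1r -E subrKC.
Qed.
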